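(* Let $G$ be a locally compact second countable group and let $X_0$ be a closed subset of $G$ such that $(X_0^{-1}X_0)^3$ is uniformly discrete. If there is a proper $G$-invariant Borel probability measure on $\Omega^{ext}_{X_0}$ (or on $\Omega_{X_0}$), then $X_0^{-1}X_0$ is an approximate subgroup, hence a $\star$-approximate lattice.
   Context: For subsets $X,Y$ of a group $G$, $XY=\{xy : x\in X,y\in Y\}$, $X^{-1}=\{x^{-1}:x\in X\}$, and $X^n$ is the $n$-fold product set. An approximate subgroup of $G$ is a subset $X\ni e$ with $X=X^{-1}$ and $X^2\subset FX$ for some finite $F\subset G$. For a locally compact second countable group $G$, a subset $X$ is uniformly discrete if $e$ is isolated in $X^{-1}X$. $\mathcal{C}(G)$ is the set of closed subsets of $G$ with the Chabauty--Fell topology, generated by the sets $U_K=\{C : C\cap K=\emptyset\}$ ($K\subset G$ compact) and $U^V=\{C: C\cap V\neq\emptyset\}$ ($V\subset G$ open); it is a compact metrizable $G$-space under $(g,X)\mapsto gX$. The invariant hull $\Omega_{X_0}$ of a closed subset $X_0$ is the closure of the orbit $\{gX_0:g\in G\}$ in $\mathcal{C}(G)$. The extended invariant hull is the closed $G$-invariant set $\Omega^{ext}_{X_0}=\{X\in\mathcal{C}(G): X^{-1}X\subset\overline{X_0^{-1}X_0}\}$, which contains $\Omega_{X_0}$. A Borel probability measure $\nu$ on either is proper if $\nu(\{\emptyset\})=0$. A $\star$-approximate lattice in $G$ is a uniformly discrete approximate subgroup $\Lambda$ such that $\Omega^{ext}_\Lambda$ carries a proper $G$-invariant Borel probability measure.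 *)

(* Defs.v *)
From HB Require Import structures.
From mathcomp Require Import all_boot all_order all_algebra.
From mathcomp Require Import all_classical all_reals all_analysis.

Set Implicit Arguments.
Unset Strict Implicit.
Unset Printing Implicit Defensive.

Import Algebra.

Local Open Scope classical_set_scope.
Local Open Scope group_scope.

HB.structure Definition PreTopologicalGroup :=
  {G of Topological G & Group G}.

HB.mixin Record PreTopologicalGroup_isTopologicalGroup G
    & PreTopologicalGroup G := {
  mulg_continuous : continuous (fun x : G * G => x.1 * x.2) ;
  invg_continuous : continuous (fun x : G => x^-1)
}.

#[short(type="topologicalGroupType")]
HB.structure Definition TopologicalGroup :=
  {G of PreTopologicalGroup G & PreTopologicalGroup_isTopologicalGroup G}.

Section SetProducts.
Context {G : groupType}.
Implicit Types X Y F : set G.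

Definition set_mulg X Y : set G := [set x * y | x in X & y in Y].
Definition set_invg X : set G := [set x^-1 | x in X].
Definition set_expg X n : set G := iterop n set_mulg X [set 1].

(* X^-1 X *)
Definition self_quot X : set G := set_mulg (set_invg X) X.

Definition approx_subgroup X :=
  [/\ X 1, X = set_invg X &
    exists2 F, finite_set F & set_expg X 2 `<=` set_mulg F X].

End SetProducts.

Definition uniformly_discrete (G : topologicalGroupType) (X : set G) :=
  isolated (self_quot X) 1.

Record closed_subset (T : topologicalType) := ClosedSubset {
  cset :> set T ;
  cset_closed : closed cset
}.

HB.instance Definition _ (T : topologicalType) := gen_eqMixin (closed_subset T).
HB.instance Definition _ (T : topologicalType) :=
  gen_choiceMixin (closed_subset T).
HB.instance Definition _ (T : topologicalType) :=
  isPointed.Build (closed_subset T) (ClosedSubset (@closed0 T)).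

Section ChabautyFell.
Context {T : topologicalType}.

Definition fell_miss (K : set T) : set (closed_subset T) :=
  [set C | (C : set T) `&` K = set0].

Definition fell_hit (V : set T) : set (closed_subset T) :=
  [set C | (C : set T) `&` V !=set0].

Definition fell_subbase : set (set (closed_subset T)) :=
  [set fell_miss K | K in compact] `|` [set fell_hit V | V in open].

End ChabautyFell.

HB.instance Definition _ (T : topologicalType) :=
  @isSubBaseTopological.Build (closed_subset T) (set (closed_subset T))
    fell_subbase id.

Section Translation.
Context {G : topologicalGroupType}.

Lemma closed_translate (g : G) (X : set G) :
  closed X -> closed [set g * x | x in X].
Proof.
have -> : [set g * x | x in X] = (fun y => g^-1 * y) @^-1` X.
  apply/seteqP; split => [_ [x Xx <-]|y Xy] /=; first by rewrite mulKg.
  by exists (g^-1 * y) => //; rewrite mulVKg.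
apply: preimage_closed => y _.
apply: (@continuous_comp _ _ _ (fun y => (g^-1, y)) (fun x : G * G => x.1 * x.2)).
  by apply: cvg_pair; [exact: cvg_cst|exact: cvg_id].
exact: mulg_continuous.
Qed.

Definition translate (g : G) (X : closed_subset G) : closed_subset G :=
  ClosedSubset (@closed_translate g X (@cset_closed _ X)).

Definition hull (X0 : closed_subset G) : set (closed_subset G) :=
  closure (range (translate ^~ X0)).

Definition ext_hull (X0 : set G) : set (closed_subset G) :=
  [set X | self_quot X `<=` closure (self_quot X0)].

End Translation.

(* The subspace A of T. The point a serves only as the default element that
   the library requires of every measurable type. *)
Definition pointed_subspace (T : topologicalType) (A : set T) (a : A) : Type :=
  A.

HB.instance Definition _ (T : topologicalType) (A : set T) (a : A) :=
  Topological.copy (pointed_subspace a) (set_type A).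
HB.instance Definition _ (T : topologicalType) (A : set T) (a : A) :=
  isPointed.Build (pointed_subspace a) a.

Notation borel_subspace a := (g_sigma_algebraType (@open (pointed_subspace a))).

Section InvariantMeasures.
Context {R : realType} {G : topologicalGroupType}.

Section OnSubspace.
Context {Omega : set (closed_subset G)} {w : Omega}.

(* The translate gB inside Omega, meant for G-invariant Omega. *)
Definition subspace_translate (g : G) (B : set (borel_subspace w)) :
    set (borel_subspace w) :=
  [set Y | exists2 X, B X & set_val Y = translate g (set_val X)].

Definition invariant_measure (nu : probability (borel_subspace w) R) :=
  forall (g : G) (B : set (borel_subspace w)), measurable B ->
    nu (subspace_translate g B) = nu B.

Definition proper_measure (nu : probability (borel_subspace w) R) :=
  nu [set X : borel_subspace w | cset (set_val X) = set0] = 0%E.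

End OnSubspace.

(* Quantifying over the point w loses nothing: a space carrying a probability
   measure is not empty. *)
Definition carries_proper_invariant_probability
    (Omega : set (closed_subset G)) :=
  exists (w : Omega) (nu : probability (borel_subspace w) R),
    proper_measure nu /\ invariant_measure nu.

End InvariantMeasures.

Arguments carries_proper_invariant_probability R {G} Omega.

Definition star_approx_lattice (R : realType) (G : topologicalGroupType)
    (Lambda : set G) :=
  [/\ uniformly_discrete Lambda, approx_subgroup Lambda &
    carries_proper_invariant_probability R (ext_hull Lambda)].

(* Main.v *)
Require Import Defs.
From HB Require Import structures.
From mathcomp Require Import all_boot all_order all_algebra.
From mathcomp Require Import all_classical all_reals all_analysis.
From mathcomp Require Import measurable_realfun ring lra.

Set Implicit Arguments.
Unset Strict Implicit.
Unset Printing Implicit Defensive.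

Import Order.TTheory GRing.Theory Num.Theory.
Import Algebra.

Local Open Scope classical_set_scope.
Local Open Scope ring_scope.
Local Open Scope group_scope.

(** Write [L] for [X0^-1 X0]. Since [L^3] is uniformly discrete, there is a
    neighbourhood [V] of [1] such that, for [h] and [k] in [L^2] and [z] in [L],
    the product [h z k^-1] lies in [V^-1 V] only if it is [1]. A closed set [X]
    with [X^-1 X] inside [L] therefore has at most one point in [V h], for every
    [h] in [L^2]; and if it meets both [V h] and [V k] then [h^-1 k] is in [L].
    So if elements of [L^2] are chosen with all quotients [h^-1 k] outside [L],
    the events that a random [X] meets [U h], for a fixed [U] inside [V], are
    disjoint. Once their probabilities are bounded below by a constant, such a
    family is finite, and a maximal one is a finite [F] with [L^2] inside [F L].

    The point is thus to bound from below the probability of meeting [U h] when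
    [h] ranges over [L^2]. The invariant measure acts on the left while [U h]
    is a right translate, so invariance is not enough. Let [mu B] be the expected
    number of points of [X] in [B] ([intensity]). It is a left-invariant
    sigma-finite measure on [G], nonzero because the random set is almost surely nonempty,
    and [mu B] is the probability that [X] meets [B] when [X] never has two
    points in [B]. In particular [mu (V h) <= 1] on [L^2]. Up to a constant
    [mu (V h)] is the modular function of [G] at [h], so this function is
    bounded on [L^2]; as [L^2] is stable under inversion, it is also bounded
    away from [0] there. The lemma [right_translate_lower_bound] makes this
    quantitative without introducing the modular function: it bounds
    [mu (U h^-1)] from below as soon as [mu (V h) <= 1], by two
    applications of a Fubini identity ([integral_right_translate]).

    What remains is to move invariant measures between hulls. The hull
    of [X0] lies in its extended hull, which lies in the extended hull of [L];
    these sets are stable under translation, and a proper invariant probability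
    is pushed forward along such inclusions ([carries_sub]). *)

(** * Topological groups and their Borel sets *)

(** A copy of [G], carrying its Borel sigma-algebra and the base point that
    measurable types require. *)
Definition borel_group (G : topologicalGroupType) : Type := G.

HB.instance Definition _ (G : topologicalGroupType) :=
  TopologicalGroup.copy (borel_group G) G.
HB.instance Definition _ (G : topologicalGroupType) :=
  isPointed.Build (borel_group G) 1.
HB.instance Definition _ (G : topologicalGroupType) :=
  Measurable.copy (borel_group G)
    (g_sigma_algebraType (@open (borel_group G))).

Lemma second_countable_basis (T : topologicalType) : @second_countable T ->
  exists2 b : nat -> set T, forall n, open (b n) &
    forall x O, nbhs x O -> exists2 n, b n x & b n `<=` O.
Proof.
move=> [B cB [oB bB]]; have [B0|[f]] := pfcard_geP cB.
  exists (fun=> set0) => [_|x O /bB [U]]; first exact: open0.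
  by rewrite B0 => -[].
exists f => [n|x O /bB [U [BU Ux] UO]]; first by apply/oB/funS.
by have [n _ fnU] := @surj _ _ _ _ f _ BU; exists n; rewrite fnU.
Qed.

Section TopologicalGroup.
Context {G : topologicalGroupType}.

Lemma continuous_mulg (T : topologicalType) (f g : T -> G) :
  continuous f -> continuous g -> continuous (fun x => f x * g x).
Proof.
move=> cf cg x.
apply: (@continuous_comp _ _ _ (fun x => (f x, g x)) (fun z => z.1 * z.2)).
  by apply: cvg_pair; [exact: cf|exact: cg].
exact: mulg_continuous.
Qed.

Lemma continuous_invg (T : topologicalType) (f : T -> G) :
  continuous f -> continuous (fun x => (f x)^-1).
Proof.
move=> cf x; apply: (@continuous_comp _ _ _ f (fun x => x^-1)); first exact: cf.
exact: invg_continuous.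
Qed.

Lemma continuous_mulgl (g : G) : continuous (fun x : G => g * x).
Proof. by apply: continuous_mulg => x; [exact: cst_continuous|]. Qed.

Lemma continuous_mulgr (g : G) : continuous (fun x : G => x * g).
Proof. by apply: continuous_mulg => x; [|exact: cst_continuous]. Qed.

Lemma nbhs_continuous_open (T : topologicalType) (f : T -> G) x (O : set G) :
  continuous f -> nbhs (f x) O -> nbhs x (f @^-1` O).
Proof. by move=> cf; exact: cf. Qed.

(** Continuity of a two-variable function at [(1, 1)]: both variables can be
    confined to one neighbourhood. *)
Lemma open_nbhs1_pair (f : G * G -> G) (O : set G) :
  continuous f -> nbhs (f (1, 1)) O ->
  exists V : set G, [/\ open V, V 1 & forall x y, V x -> V y -> O (f (x, y))].
Proof.
move=> cf /cf [[A B] /= [A1 B1] AB].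
have : nbhs (1 : G) (A `&` B) by apply: filterI.
rewrite nbhsE => -[V [oV V1] VAB]; exists V; split=> // x y Vx Vy.
by apply: AB; split; [exact: (VAB _ Vx).1|exact: (VAB _ Vy).2].
Qed.

(** The Lindelof property: it is enough to pick one translate of [V] for
    each basic open set that fits inside some translate. *)
Lemma translates_cover (V : set G) : @second_countable G -> open V -> V 1 ->
  exists g : nat -> G, forall x, exists n, V (g n * x).
Proof.
move=> /second_countable_basis [b ob bP] oV V1.
pose P n g := b n `<=` [set x | V (g * x)].
exists (fun n => xget 1 [set g | P n g]) => x.
have : nbhs x [set y | V (x^-1 * y)].
  apply: (nbhs_continuous_open (f := fun y => x^-1 * y)).
    exact: continuous_mulgl.
  by rewrite mulVg; apply: open_nbhs_nbhs.
move=> /bP [n bnx bnV]; exists n; case: xgetP => [g _ /(_ x bnx)//|].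
by move=> /(_ x^-1) [].
Qed.

End TopologicalGroup.

Section BorelGroup.
Context {G : topologicalGroupType}.
Local Notation T := (borel_group G).

Lemma open_measurable_group (A : set T) : open A -> measurable A.
Proof. by move=> oA; apply: sub_sigma_algebra. Qed.

Lemma measurable_fun_open d (S : measurableType d) (f : S -> T) :
  (forall O : set T, open O -> measurable (f @^-1` O)) ->
  measurable_fun setT f.
Proof.
move=> fO; apply: (measurability (@open T)) => // _ [U oU <-].
by rewrite setTI; exact: fO.
Qed.

Lemma continuous_measurable_group (f : T -> T) :
  continuous f -> measurable_fun setT f.
Proof.
move=> cf; apply: measurable_fun_open => O oO; apply: open_measurable_group.
by apply: open_comp => // x _; exact: cf.
Qed.

Lemma measurable_mulgl (g : T) (A : set T) : measurable A ->
  measurable [set x | A (g * x)].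
Proof.
move=> mA; rewrite -[X in measurable X]setTI.
by apply: (continuous_measurable_group (@continuous_mulgl G g)).
Qed.

Lemma measurable_mulgr (g : T) (A : set T) : measurable A ->
  measurable [set x | A (x * g)].
Proof.
move=> mA; rewrite -[X in measurable X]setTI.
by apply: (continuous_measurable_group (@continuous_mulgr G g)).
Qed.

Lemma measurable_invg (A : set T) : measurable A ->
  measurable [set x : T | A (x^-1)].
Proof.
move=> mA; rewrite -[X in measurable X]setTI.
by apply: (continuous_measurable_group (@invg_continuous G)).
Qed.

(** Second countability makes every open subset of [G * G] a countable union
    of open rectangles, so that it lies in the product sigma-algebra. *)
Lemma continuous_measurable_group2 (f : T * T -> T) : @second_countable G ->
  continuous f -> measurable_fun setT f.
Proof.
move=> /second_countable_basis [b ob bP] cf.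
apply: measurable_fun_open => O oO.
pose W := f @^-1` O.
have oW : open W by apply: open_comp => // x _; exact: cf.
have -> : f @^-1` O =
    \bigcup_m \bigcup_(n in [set n | b m `*` b n `<=` W]) (b m `*` b n).
  apply/seteqP; split => [[x y] Wxy|z [m _ [n mnW mnz]]]; last exact: mnW.
  have /nbhs_interior/= : nbhs (x, y) W by apply: open_nbhs_nbhs.
  move=> [[P Q] /= [/bP [m bmx bmP] /bP [n bny bnQ]] PQ].
  exists m => //; exists n => //= -[u v] [/= /bmP Pu /bnQ Qv].
  by apply: (@interior_subset _ W); apply: PQ; split.
apply: bigcupT_measurable => m; apply: bigcup_measurable => n _.
by apply: measurableX; apply: open_measurable_group; exact: ob.
Qed.

End BorelGroup.

(** * Left-invariant measures *)

(** Right translates are written as preimages: [[set y | A (y * x)]] is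
    [A x^-1]. *)

Section LeftInvariant.
Context {R : realType} {G : topologicalGroupType}.
Local Notation T := (borel_group G).
Variable mu : {sigma_finite_measure set T -> \bar R}.
Hypothesis second_countableG : @second_countable G.
Hypothesis mu_left_invariant : forall (g : T) (A : set T), measurable A ->
  mu [set x | A (g * x)] = mu A.

(** Both sides are the product measure of [E], computed by slicing along one
    coordinate or the other. *)
Lemma integral_section_swap (E : set (T * T)) : measurable E ->
  (\int[mu]_x mu (xsection E x) = \int[mu]_y mu (ysection E y))%E.
Proof.
move=> mE; change ((mu \x mu)%E E = (mu \x^ mu)%E E).
apply: product_measure_unique => // A B mA mB.
exact: product_measure2E.
Qed.

Local Lemma measurable_mulg2 (A B : set T) (f g : T * T -> T) :
  continuous f -> continuous g -> measurable A -> measurable B ->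
  measurable [set z : T * T | A (f z) /\ B (g z)].
Proof.
move=> cf cg mA mB; apply: measurableI; rewrite -[X in measurable X]setTI.
  exact: (continuous_measurable_group2 second_countableG cf).
exact: (continuous_measurable_group2 second_countableG cg).
Qed.

Lemma measurable_fun_right_translate (A : set T) : measurable A ->
  measurable_fun setT ((fun x : T => mu [set y : T | A (y * x)]) : T -> \bar R).
Proof.
move=> mA; pose E : set (T * T) := [set z : T * T | A (z.2 * z.1)].
have mE : measurable E.
  rewrite (_ : E = [set z : T * T | A (z.2 * z.1) /\ A (z.2 * z.1)]).
    by apply: measurable_mulg2 => //; apply: continuous_mulg => -[x y];
      [exact: cvg_snd|exact: cvg_fst|exact: cvg_snd|exact: cvg_fst].
  by apply/seteqP; split => z; [split|case].
rewrite (_ : (fun x : T => _) = mu \o xsection E).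
  exact: measurable_fun_xsection.
by apply/funext => x /=; congr (mu _); apply/seteqP; split => y;
  rewrite /xsection /= inE.
Qed.

(** The set of [(x, y)] with [x] in [B] and [y x] in [A] is sliced first along
    [x], then along [y]; left invariance replaces the slice at [y] by its
    translate by [y], and slicing the resulting set along the other coordinate
    gives the constant [mu B^-1] over each point of [A]. For a Haar measure this
    says that inversion has the inverse of the modular function as density. *)
Lemma integral_right_translate (A B : set T) : measurable A -> measurable B ->
  (\int[mu]_(x in B) mu [set y : T | A (y * x)%g] =
   mu A * mu [set y : T | B (y^-1)%g])%E.
Proof.
move=> mA mB.
have c1 : continuous (fst : T * T -> T) by move=> -[x y]; exact: cvg_fst.
have c2 : continuous (snd : T * T -> T) by move=> -[x y]; exact: cvg_snd.
pose E1 : set (T * T) := [set z : T * T | B z.1 /\ A (z.2 * z.1)].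
pose E2 : set (T * T) := [set z : T * T | A z.1 /\ B (z.2^-1 * z.1)].
have mE1 : measurable E1 by apply: measurable_mulg2 => //; apply: continuous_mulg.
have mE2 : measurable E2.
  apply: measurable_mulg2 => //; apply: continuous_mulg => //.
  exact: continuous_invg.
transitivity (\int[mu]_x mu (xsection E1 x))%E.
  rewrite integral_mkcond; apply: eq_integral => x _; rewrite patchE.
  case: ifPn => xB.
    congr (mu _); apply/seteqP; split => y; rewrite /xsection /= inE /E1 /=.
      by move=> Ayx; split=> //; exact: set_mem.
    by case.
  rewrite (_ : xsection E1 x = set0) ?measure0//.
  apply/seteqP; split => y //; rewrite /xsection /= inE /E1 /= => -[Bx _].
  by move: xB; rewrite notin_setE.
rewrite integral_section_swap//.
transitivity (\int[mu]_y mu (ysection E2 y))%E.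
  apply: eq_integral => y _.
  rewrite (_ : ysection E2 y = [set x | ysection E1 y (y^-1 * x)]).
    by rewrite mu_left_invariant//; exact: measurable_ysection.
  apply/seteqP; split => x; rewrite /ysection /= !inE /E1 /E2 /= mulVKg;
    by case.
rewrite -integral_section_swap//.
transitivity (\int[mu]_(x in A) cst (mu [set y : T | B (y^-1)%g]) x)%E.
  rewrite [RHS]integral_mkcond; apply: eq_integral => x _; rewrite patchE.
  case: ifPn => xA.
    rewrite /= -[RHS](mu_left_invariant x^-1)//; last exact: measurable_invg.
    congr (mu _); apply/seteqP; split => y; rewrite /xsection /= inE /E2 /=.
      by case=> _; rewrite invgM invgK.
    by rewrite invgM invgK; split=> //; exact: set_mem.
  rewrite (_ : xsection E2 x = set0) ?measure0//.
  apply/seteqP; split => y //; rewrite /xsection /= inE /E2 /= => -[Ax _].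
  by move: xA; rewrite notin_setE.
by rewrite integral_cst// muleC.
Qed.

(** Countably many translates of [V] cover the group. *)
Lemma open_measure_gt0 (V : set T) :
  open V -> V 1 -> mu setT != 0%E -> (0 < mu V)%E.
Proof.
move=> oV V1; rewrite lt0e measure_ge0 andbT; apply: contra_neq => muV0.
have [g gV] := translates_cover second_countableG oV V1.
have mV := open_measurable_group oV.
apply/negligibleP => //.
have -> : setT = \bigcup_n [set x : T | V (g n * x)].
  by apply/esym; rewrite -subTset => x _; have [n] := gV x; exists n.
apply: negligible_bigcup => n; apply/negligibleP; first exact: measurable_mulgl.
exact: etrans (mu_left_invariant (g n) mV) muV0.
Qed.

(** Let [f x] be [mu (V x^-1)]. By [integral_right_translate], the bound on
    [mu (V h)] and [mu U^-1] make the integral of [f (x h^-1)] over [x] in [U] at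
    most [1]; by Markov's inequality [f (x h^-1)] is at most [M = 2 / u] on a part [U2] of
    [U] of measure at least [u / 2]. The same identity evaluates
    [mu V * mu U2^-1] in two ways: as the integral of [f] over [U2], where
    [f >= u] since [U] lies in [V x^-1], and as the integral of [f] over
    [U2 h^-1], where [f <= M]. Comparing them bounds [mu (U h^-1)] from below
    by [u (u / 2) / M]. *)
Lemma right_translate_lower_bound (U V : set T) (h : T) (u : R) :
  measurable U -> measurable V -> (0 < u)%R -> mu U = u%:E ->
  (forall x y, U x -> U y -> V (x * y)) ->
  (mu [set y : T | U (y^-1)%g] <= 1)%E ->
  (mu [set y : T | V (y * h^-1)%g] <= 1)%E ->
  ((u ^+ 3 / 4)%R%:E <= mu [set y : T | U (y * h)%g])%E.
Proof.
move=> mU mV u_gt0 muU UV muUi muVh.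
pose f (x : T) : \bar R := mu [set y : T | V (y * x)].
have mf : measurable_fun setT f by exact: measurable_fun_right_translate.
have mVh := measurable_mulgr h^-1 mV.
pose g (x : T) : \bar R := mu [set y : T | V (y * x * h^-1)].
have mg : measurable_fun setT g.
  exact: (measurable_fun_right_translate mVh).
have gE x : g x = f (x * h^-1).
  by rewrite /g /f; congr (mu _); apply/seteqP; split => y /=; rewrite mulgA.
pose M : R := (2 / u)%R.
have M_gt0 : (0 < M)%R by rewrite divr_gt0.
have mlarge : measurable [set x | M%:E <= g x]%E.
  by rewrite -[X in measurable X]setTI; exact: emeasurable_fun_c_infty.
pose U1 := U `&` [set x | M%:E <= g x]%E.
pose U2 := U `\` [set x | M%:E <= g x]%E.
have mU1 : measurable U1 by exact: measurableI.
have mU2 : measurable U2 by exact: measurableD.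
have muU1 : (M%:E * mu U1 <= 1)%E.
  rewrite -integral_cst//.
  apply: (@le_trans _ _ (\int[mu]_(x in U) g x)%E).
    apply: (@le_trans _ _ (\int[mu]_(x in U1) g x)%E).
      apply: ge0_le_integral => //.
      - by move=> x _ /=; rewrite lee_fin ltW.
      - exact: measurable_funTS.
      - by move=> x [].
    apply: ge0_subset_integral => //; first exact: measurable_funTS.
    exact: subIsetl.
  rewrite (integral_right_translate mVh mU) -[leRHS]mule1.
  by apply: lee_pmul.
have muU2 : ((u / 2)%R%:E <= mu U2)%E.
  have muUE : (u%:E = mu U1 + mu U2)%E by rewrite -muU addeC; exact: measureDI.
  have [x1 U1E] : exists r : R, mu U1 = r%:E.
    exists (fine (mu U1)); rewrite fineK// ge0_fin_numE//.
    apply: (le_lt_trans (le_measure mu _ _ (@subIsetl _ U _))); rewrite ?inE//.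
    by rewrite [X in (X < _)%E]muU ltry.
  have [x2 U2E] : exists r : R, mu U2 = r%:E.
    exists (fine (mu U2)); rewrite fineK// ge0_fin_numE//.
    apply: (le_lt_trans (le_measure mu _ _ (@subDsetl _ U _))); rewrite ?inE//.
    by rewrite [X in (X < _)%E]muU ltry.
  move: muU1 muUE; rewrite U1E U2E -EFinM -EFinD !lee_fin => Mx1 -[uE].
  rewrite /M mulrAC ler_pdivrMr// mul1r in Mx1.
  rewrite ler_pdivrMr//. lra.
have muVi : (u%:E * mu U2 <= mu V * mu [set y : T | U2 (y^-1)%g])%E.
  rewrite -integral_right_translate// -integral_cst//.
  apply: ge0_le_integral => //.
  - by move=> x _ /=; rewrite lee_fin ltW.
  - exact: measurable_funTS.
  - move=> x [Ux _]; rewrite -muU; apply: le_measure; rewrite ?inE//.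
      exact: measurable_mulgr.
    by move=> y Uy; exact: UV.
have muVi' : (mu V * mu [set y : T | U2 (y^-1)%g] <=
    M%:E * mu [set y : T | U (y * h)%g])%E.
  have -> : mu [set y : T | U2 (y^-1)] = mu [set y : T | U2 (y^-1 * h)].
    rewrite -(mu_left_invariant h^-1); last exact: measurable_invg.
    by congr (mu _); apply/seteqP; split => y /=; rewrite invgM invgK.
  rewrite -(integral_right_translate mV (measurable_mulgr h mU2)).
  apply: (@le_trans _ _
    (\int[mu]_(x in [set y : T | U2 (y * h)%g]) cst M%:E x)%E).
    apply: ge0_le_integral => //.
    - exact: measurable_mulgr.
    - exact: measurable_funTS.
    - move=> x [_ /negP]; rewrite -ltNge gE mulgK => /ltW//.
  rewrite integral_cst; last exact: measurable_mulgr.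
  rewrite lee_pmul2l//; apply: le_measure; rewrite ?inE.
  - exact: measurable_mulgr.
  - exact: measurable_mulgr.
  - by move=> y [].
have : (u%:E * (u / 2)%R%:E <= M%:E * mu [set y : T | U (y * h)%g])%E.
  apply: le_trans muVi'; apply: le_trans muVi.
  by rewrite lee_pmul2l ?lte_fin.
rewrite -lee_pdivrMl// -!EFinM; apply: le_trans; rewrite lee_fin /M.
by rewrite invfM invrK le_eqVlt; apply/orP; left; apply/eqP; field.
Qed.

End LeftInvariant.

(** * The intensity of a random set *)

(** The random set is a map [C] from a probability space to subsets of the
    group. *)

Section RandomSet.
Context {R : realType} {G : topologicalGroupType}.
Local Notation T := (borel_group G).
Context d (Omega : measurableType d) (nu : probability Omega R).
Variable C : Omega -> set T.

Definition hits (A : set T) : set Omega := [set w | C w `&` A !=set0].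

Definition thin (A : set T) :=
  forall w x y, C w x -> C w y -> A x -> A y -> x = y.

Lemma sub_thin (A B : set T) : A `<=` B -> thin B -> thin A.
Proof. by move=> AB tB w x y Cx Cy /AB Bx /AB By; exact: (tB w). Qed.

Lemma hits_bigcup (F : nat -> set T) :
  hits (\bigcup_n F n) = \bigcup_n hits (F n).
Proof.
apply/seteqP; split=> [w [x [Cx [n _ Fx]]]|w [n _ [x [Cx Fx]]]].
  by exists n => //; exists x.
by exists x; split=> //; exists n.
Qed.

Lemma trivIset_hits (A : set T) (F : nat -> set T) : thin A ->
  trivIset setT F -> trivIset setT (fun n => hits (F n `&` A)).
Proof.
move=> tA /trivIsetP tF; apply/trivIsetP => i j _ _ ij.
rewrite -subset0 => w [[x [Cx [Fx Ax]]] [y [Cy [Fy Ay]]]].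
have xy : x = y by exact: (tA w).
have : (F i `&` F j) x by split=> //; rewrite xy.
by rewrite tF.
Qed.

(** On a set [A] where the random set has at most one point, the number of
    points in [B `&` A] is the indicator of the event [hits (B `&` A)], so the
    probability of that event is additive in [B]. *)
Section ThinMeasure.
Variable A : set T.
Hypothesis measurable_hitsA :
  forall B, measurable B -> measurable (hits (B `&` A)).
Hypothesis thinA : thin A.

Definition thin_measure (B : set T) : \bar R := nu (hits (B `&` A)).

Let thin_measure0 : thin_measure set0 = 0%E.
Proof.
rewrite /thin_measure set0I (_ : hits set0 = set0) ?measure0//.
by rewrite -subset0 => w [x []].
Qed.

Let thin_measure_ge0 B : (0 <= thin_measure B)%E.
Proof. exact: measure_ge0. Qed.

Let thin_measure_sigma_additive : semi_sigma_additive thin_measure.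
Proof.
move=> F mF tF mUF; rewrite /thin_measure setI_bigcupl hits_bigcup.
apply: measure_semi_sigma_additive.
- by move=> n; exact: measurable_hitsA.
- exact: trivIset_hits.
- by apply: bigcupT_measurable => n; exact: measurable_hitsA.
Qed.

HB.instance Definition _ := isMeasure.Build _ _ _ thin_measure
  thin_measure0 thin_measure_ge0 thin_measure_sigma_additive.

Definition thin_part_measure : {measure set T -> \bar R} := thin_measure.

End ThinMeasure.

Hypothesis measurable_hits_open : forall O, open O -> measurable (hits O).

(** The sets [B] for which the event is measurable form a sigma-algebra: since
    the random set has at most one point in [V], it meets [V] outside [D] if and
    only if it meets [V] but does not meet [D `&` V]. *)
Lemma measurable_hits_thin (V B : set T) : open V -> thin V -> measurable B ->
  measurable (hits (B `&` V)).
Proof.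
move=> oV tV; suff: @measurable _ T `<=` [set B | measurable (hits (B `&` V))].
  exact.
apply: smallest_sub; last first.
  by move=> U oU /=; apply: measurable_hits_open; exact: openI.
split=> [|D mD|F mF] /=.
- rewrite set0I (_ : hits set0 = set0)//.
  by rewrite -subset0 => w [x []].
- rewrite (_ : hits _ = hits V `\` hits (D `&` V)).
    by apply: measurableD => //; exact: measurable_hits_open.
  apply/seteqP; split=> w.
    move=> [x [Cx [[_ nDx] Vx]]]; split; first by exists x.
    by move=> [y [Cy [Dy Vy]]]; apply: nDx; rewrite (tV w x y).
  move=> [[x [Cx Vx]] nw]; exists x; split=> //; split=> //; split=> // Dx.
  by apply: nw; exists x.
- rewrite setI_bigcupl hits_bigcup; exact: bigcupT_measurable.
Qed.

Variable V : nat -> set T.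
Hypothesis openV : forall n, open (V n).
Hypothesis thinV : forall n, thin (V n).
Hypothesis coverV : forall x, exists n, V n x.

(* A Borel partition of the group into sets containing at most one point of
   the random set *)
Local Notation cell := (seqDU V).

Local Lemma measurable_cell n : measurable (cell n).
Proof.
apply: measurableD; first exact: open_measurable_group.
by apply: bigsetU_measurable => k _; exact: open_measurable_group.
Qed.

Local Lemma thin_cell n : thin (cell n).
Proof. by apply: (@sub_thin _ (V n)) => //; exact: subset_seqDU. Qed.

Local Lemma cover_cell : \bigcup_n cell n = setT.
Proof.
rewrite -seqDU_bigcup_eq -subTset => x _.
by have [n] := coverV x; exists n.
Qed.

Local Lemma measurable_hits_cell n B :
  measurable B -> measurable (hits (B `&` cell n)).
Proof.
move=> mB; have -> : B `&` cell n = B `&` cell n `&` V n.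
  by rewrite -setIA (setIidl (@subset_seqDU _ V n)).
apply: measurable_hits_thin => //.
by apply: measurableI => //; exact: measurable_cell.
Qed.

Lemma measurable_hits_borel B : measurable B -> measurable (hits B).
Proof.
move=> mB; rewrite -[B]setIT -cover_cell setI_bigcupr hits_bigcup.
by apply: bigcupT_measurable => n; exact: measurable_hits_cell.
Qed.

Definition cell_series : set T -> \bar R :=
  mseries (fun n => thin_part_measure (@measurable_hits_cell n) (@thin_cell n)) 0.

HB.instance Definition _ := Measure.on cell_series.

Lemma cell_series_thin (A : set T) : measurable A -> thin A ->
  cell_series A = nu (hits A).
Proof.
move=> mA tA; rewrite -[A in RHS]setIT -cover_cell setI_bigcupr hits_bigcup.
have mF n : measurable (hits (A `&` cell n)) by exact: measurable_hits_cell.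
rewrite measure_semi_bigcup//; last exact: bigcupT_measurable.
under eq_fun do rewrite setIC.
exact: trivIset_hits tA (@trivIset_seqDU _ V).
Qed.

Let cell_series_sigma_finite : sigma_finite setT cell_series.
Proof.
exists cell => [|n]; first by rewrite cover_cell.
split; first exact: measurable_cell.
rewrite cell_series_thin; [|exact: measurable_cell|exact: thin_cell].
have mn := @measurable_hits_cell n _ measurableT; rewrite setTI in mn.
by apply: le_lt_trans (probability_le1 nu mn) _; rewrite ltry.
Qed.

HB.instance Definition _ :=
  Measure_isSigmaFinite.Build _ _ _ cell_series cell_series_sigma_finite.

(** The measure [B |-> E #|C `&` B|], written as a sum over the cells. *)
Definition intensity : {sigma_finite_measure set T -> \bar R} := cell_series.

Lemma intensity_thin (A : set T) : measurable A -> thin A ->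
  intensity A = nu (hits A).
Proof. exact: cell_series_thin. Qed.

Lemma intensity_neq0 : nu (hits setT) != 0%E -> intensity setT != 0%E.
Proof.
apply: contra_neq => i0; apply/negligibleP.
  exact: measurable_hits_open openT.
rewrite -cover_cell hits_bigcup; apply: negligible_bigcup => n.
have mn := @measurable_hits_cell n _ measurableT; rewrite setTI in mn.
apply/negligibleP => //; apply/eqP; rewrite eq_le measure_ge0 andbT.
change (nu (hits (cell n)) <= 0)%E.
rewrite -(intensity_thin (@measurable_cell n) (@thin_cell n)).
by rewrite -i0; apply: le_measure; rewrite ?inE//; exact: measurable_cell.
Qed.

Section Equivariant.
Variable act : T -> Omega -> Omega.
Hypothesis act_C : forall g w x, C (act g w) x <-> C w (g^-1 * x).
Hypothesis nu_invariant : forall g E, measurable E -> nu (act g @^-1` E) = nu E.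

Lemma hits_left_translate (g : T) (A : set T) :
  hits [set x | A (g * x)] = act g @^-1` hits A.
Proof.
apply/seteqP; split=> w [x [Cx Ax]].
  by exists (g * x); split=> //; apply/act_C; rewrite mulKg.
by exists (g^-1 * x); split; [exact/act_C|rewrite /= mulVKg].
Qed.

Lemma thin_left_translate (g : T) (A : set T) :
  thin A -> thin [set x | A (g * x)].
Proof.
move=> tA w x y Cx Cy Ax Ay; apply: (@mulgI G g).
by apply: (tA (act g w)) => //; apply/act_C; rewrite mulKg.
Qed.

(** On each piece [A `&` cell n] the intensity is a hitting probability, and
    these are invariant; a translate of a cell need not be a cell, but it is
    still thin. *)
Lemma intensity_left_invariant (g : T) (A : set T) : measurable A ->
  intensity [set x | A (g * x)] = intensity A.
Proof.
move=> mA.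
have mAn n : measurable (A `&` cell n).
  by apply: measurableI => //; exact: measurable_cell.
have tAn n : thin (A `&` cell n).
  by apply: (@sub_thin _ (cell n)); [exact: subIsetr|exact: thin_cell].
have tF : trivIset setT (fun n => A `&` cell n).
  exact/trivIset_setIl/(trivIset_seqDU V).
have AE : A = \bigcup_n (A `&` cell n) by rewrite -setI_bigcupr cover_cell setIT.
rewrite [in RHS]AE [in LHS]AE.
rewrite (_ : [set x | _ (g * x)] =
  \bigcup_n [set x : T | (A `&` cell n) (g * x)])//.
have mG n : measurable [set x : T | (A `&` cell n) (g * x)].
  exact: measurable_mulgl.
have tG : trivIset setT (fun n => [set x : T | (A `&` cell n) (g * x)]).
  apply/trivIsetP => i j _ _ ij; rewrite -subset0 => x [/= Ai Aj].
  have /trivIsetP tF' := tF.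
  have := tF' i j Logic.I Logic.I ij.
  by rewrite -subset0 => /(_ (g * x)); apply.
have inv_cell n : intensity [set x : T | (A `&` cell n) (g * x)] =
    intensity (A `&` cell n).
  rewrite (intensity_thin (mG n) (thin_left_translate (tAn n))).
  rewrite (intensity_thin (mAn n) (tAn n)) hits_left_translate nu_invariant//.
  exact: measurable_hits_cell.
rewrite !measure_semi_bigcup//; [|exact: bigcupT_measurable..].
by apply: eq_eseriesr => n _; exact: inv_cell.
Qed.

End Equivariant.

End RandomSet.

(** * Hulls in the Chabauty-Fell topology *)

Section FellTopology.
Context {T : topologicalType}.

Lemma closed_subset_inj (X Y : closed_subset T) : (X : set T) = Y -> X = Y.
Proof.
case: X => X cX; case: Y => Y cY /= XY; rewrite XY in cX *.
by rewrite (Prop_irrelevance cX cY).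
Qed.

Lemma fell_subbase_open (A : set (closed_subset T)) : fell_subbase A -> open A.
Proof.
move=> sA; exists [set A] => [_ ->|]; last by rewrite bigcup_set1.
exact: (@finI_from1 _ _ _ id).
Qed.

Lemma fell_continuous (S : topologicalType) (f : S -> closed_subset T) :
  (forall A, fell_subbase A -> open (f @^-1` A)) -> continuous f.
Proof.
move=> fA; apply/continuousP => A [D sD <-].
rewrite preimage_bigcup; apply: bigcup_open => B /sD [E sE <-].
rewrite preimage_bigcap bigcap_fset big_seq.
elim/big_ind : _ => [|P Q|K /sE]; [exact: openT|exact: openI|].
by move=> /set_mem; exact: fA.
Qed.

Lemma open_fell_hit (V : set T) : open V -> open (fell_hit V).
Proof. by move=> oV; apply: fell_subbase_open; right; exists V. Qed.

End FellTopology.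

Section Hulls.
Context {G : topologicalGroupType}.
Implicit Types (X Y : closed_subset G) (A : set G).

Lemma self_quotP A z :
  self_quot A z <-> exists x y, [/\ A x, A y & z = x^-1 * y].
Proof.
split=> [[_ [x Ax <-] [y Ay <-]]|[x [y [Ax Ay ->]]]]; first by exists x, y.
by exists x^-1; [exists x|exists y].
Qed.

Lemma translateP g X x : cset (translate g X) x <-> cset X (g^-1 * x).
Proof.
split=> [[y Xy <-]|Xx]; first by rewrite mulKg.
by exists (g^-1 * x); rewrite ?mulVKg.
Qed.

Lemma translateK g X : translate g^-1 (translate g X) = X.
Proof.
apply: closed_subset_inj; apply/seteqP; split=> x.
  by move=> /translateP /translateP; rewrite invgK mulKg.
by move=> Xx; apply/translateP/translateP; rewrite invgK mulKg.
Qed.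

Lemma translateVK g X : translate g (translate g^-1 X) = X.
Proof. by rewrite -{1}[g]invgK translateK. Qed.

Lemma translate_continuous g : continuous (@translate G g).
Proof.
apply: fell_continuous => A [[K cK <-]|[V oV <-]]; apply: fell_subbase_open.
- left; exists [set g^-1 * x | x in K].
    apply: continuous_compact => //.
    by apply: continuous_subspaceT => x; exact: continuous_mulgl.
  apply/seteqP; split=> X /=; rewrite /fell_miss /= -!subset0 => XK.
    move=> x [/translateP Xx Kx]; apply: (XK (g^-1 * x)); split=> //.
    by exists x.
  move=> y [Xy [x Kx xE]]; apply: (XK x); split=> //.
  by apply/translateP; rewrite xE.
- right; exists [set x | V (g * x)].
    apply: open_comp => // x _; exact: continuous_mulgl.
  apply/seteqP; split=> X /= [x [Xx Vx]].
    by exists (g * x); split=> //; apply/translateP; rewrite mulKg.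
  by exists (g^-1 * x); split; [exact/translateP|rewrite /= mulVKg].
Qed.

Lemma hull_translate g X0 X : hull X0 X -> hull X0 (translate g X).
Proof.
move=> hX B /translate_continuous /hX [_ [[h _ <-] Bh]].
exists (translate g (translate h X0)); split=> //.
exists (g * h) => //; apply: closed_subset_inj; apply/seteqP; split=> x.
  by move=> /translateP; rewrite invgM -mulgA => ?; do 2 apply/translateP.
by move=> /translateP /translateP ?; apply/translateP; rewrite invgM -mulgA.
Qed.

Lemma ext_hull_translate g A X : ext_hull A X -> ext_hull A (translate g X).
Proof.
move=> hX _ /self_quotP [x [y [/translateP Xx /translateP Xy ->]]].
apply: hX; apply/self_quotP; exists (g^-1 * x), (g^-1 * y); split=> //.
by rewrite invgM invgK mulgA mulgK.
Qed.

(** The extended hull contains the translates of [X0] and is closed: if [x] and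
    [y] are in [X] and [P^-1 Q] is a small neighbourhood of [x^-1 y], some
    translate of [X0] close to [X] meets both [P] and [Q]. *)
Lemma hull_sub_ext_hull X0 : hull X0 `<=` ext_hull X0.
Proof.
move=> X hX _ /self_quotP [x [y [Xx Xy ->]]] B.
have cf : continuous (fun z : G * G => z.1^-1 * z.2).
  apply: continuous_mulg; last by move=> -[? ?]; exact: cvg_snd.
  by apply: continuous_invg => -[? ?]; exact: cvg_fst.
move=> /(cf (x, y)) [[P Q] /= [xP yQ] PQ].
have [_ [[g _ <-] [[a [ga Pa]] [b [gb Qb]]]]] :
    (range (translate ^~ X0) `&` (fell_hit P^° `&` fell_hit Q^°)) !=set0.
  apply: hX; apply: filterI; apply: open_nbhs_nbhs; split.
  - by apply: open_fell_hit; exact: open_interior.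
  - by exists x.
  - by apply: open_fell_hit; exact: open_interior.
  - by exists y.
exists (a^-1 * b); split; last first.
  by apply: (PQ (a, b)); split; exact: interior_subset.
move: ga gb => /translateP Xa /translateP Xb.
apply/self_quotP; exists (g^-1 * a), (g^-1 * b); split=> //.
by rewrite invgM invgK mulgA mulgK.
Qed.

End Hulls.

(** * Invariant measures on larger hulls *)

Section Enlarge.
Context {R : realType} {G : topologicalGroupType}.
Variables (Om Om' : set (closed_subset G)) (w : Om).
Hypothesis sub : Om `<=` Om'.

Definition hull_incl (X : Om) : Om' :=
  SigSub (mem_set (sub (set_valP X))).

Let w' : Om' := hull_incl w.

Definition borel_incl (X : borel_subspace w) : borel_subspace w' := hull_incl X.

Let measurable_borel_incl : measurable_fun setT borel_incl.
Proof.
apply: (@measurability _ _ _ (borel_subspace w') _ _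
  (@open (pointed_subspace w'))).
  by [].
move=> _ [_ [V oV <-] <-].
by rewrite setTI; apply: sub_sigma_algebra; exists V.
Qed.

HB.instance Definition _ :=
  isMeasurableFun.Build _ _ _ _ borel_incl measurable_borel_incl.

(** Translates taken inside [Om'] restrict to translates inside [Om] because
    [Om] is stable under all translations, inverse ones included. *)
Lemma enlarge_invariant_probability (nu : probability (borel_subspace w) R) :
  (forall g X, Om X -> Om (translate g X)) ->
  proper_measure nu -> invariant_measure nu ->
  carries_proper_invariant_probability R Om'.
Proof.
move=> OmG nu_proper nu_inv; exists w', (distribution nu borel_incl); split.
  exact: nu_proper.
move=> g B mB.
change (nu (borel_incl @^-1` subspace_translate g B) = nu (borel_incl @^-1` B)).
rewrite -[RHS](nu_inv g); last first.
  by rewrite -[X in measurable X]setTI; exact: measurable_borel_incl.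
congr (nu _); apply/seteqP; split=> Y [X BX YX].
  have OmX : Om (set_val X).
    rewrite -(translateK g (set_val X)) -YX; apply: OmG.
    exact: (set_valP (Y : Om)).
  exists (SigSub (mem_set OmX)) => //=.
  by rewrite (_ : borel_incl _ = X)//; exact: val_inj.
by exists (borel_incl X).
Qed.

End Enlarge.

Lemma carries_sub (R : realType) (G : topologicalGroupType)
    (Om Om' : set (closed_subset G)) : Om `<=` Om' ->
  (forall g X, Om X -> Om (translate g X)) ->
  carries_proper_invariant_probability R Om ->
  carries_proper_invariant_probability R Om'.
Proof.
move=> sub OmG [w [nu [nuP nuI]]].
exact: (enlarge_invariant_probability sub OmG nuP nuI).
Qed.

(** * The difference set of a set with discrete differences *)

Section Difference.
Context {G : topologicalGroupType}.
Variable A : set G.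
Local Notation L := (self_quot A).

Lemma self_quotV z : L z -> L z^-1.
Proof.
move=> /self_quotP [x [y [Ax Ay ->]]]; apply/self_quotP.
by exists y, x; rewrite invgM invgK.
Qed.

Lemma self_quot_inv : L = set_invg L.
Proof.
apply/seteqP; split=> [z Lz|_ [z Lz <-]]; last exact: self_quotV.
by exists z^-1; [exact: self_quotV|rewrite invgK].
Qed.

Lemma expg2_self_quotV z : set_expg L 2 z -> set_expg L 2 z^-1.
Proof.
move=> [a La [b Lb <-]]; exists b^-1; first exact: self_quotV.
by exists a^-1; [exact: self_quotV|rewrite invgM].
Qed.

Lemma expg2_sandwich h k z : set_expg L 2 h -> set_expg L 2 k -> L z -> L 1 ->
  self_quot (set_expg L 3) (h * z * k^-1).
Proof.
move=> [a La [b Lb <-]] [c Lc [d Ld <-]] Lz L1; apply/self_quotP.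
exists (z^-1 * (b^-1 * a^-1)), (1 * (d^-1 * c^-1)); split.
- exists z^-1; first exact: self_quotV.
  exists (b^-1 * a^-1) => //; exists b^-1; first exact: self_quotV.
  by exists a^-1; first exact: self_quotV.
- exists 1 => //; exists (d^-1 * c^-1) => //.
  exists d^-1; first exact: self_quotV.
  by exists c^-1; first exact: self_quotV.
- by rewrite !invgM !invgK mul1g !mulgA.
Qed.

Hypothesis ud : uniformly_discrete (set_expg L 3).

Lemma uniformly_discrete_nonempty : A !=set0.
Proof.
case: ud => /set_mem /self_quotP [_ [y [_ [a La _] _]]] _.
by move: La => /self_quotP [x [_ [Ax _ _]]]; exists x.
Qed.

Lemma self_quot1 : L 1.
Proof.
have [x Ax] := uniformly_discrete_nonempty; apply/self_quotP.
by exists x, x; rewrite mulVg.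
Qed.

Lemma expg2_1 : set_expg L 2 1.
Proof.
by exists 1; [exact: self_quot1|exists 1; [exact: self_quot1|rewrite mulg1]].
Qed.

Lemma sub_expg2 z : L z -> set_expg L 2 z.
Proof.
by move=> Lz; exists z => //; exists 1; [exact: self_quot1|rewrite mulg1].
Qed.

(** The form in which discreteness is used: [h z k^-1] is in the sixth power of
    [L], in which [1] is isolated, and [V^-1 V] meets that power only at [1]. *)
Lemma isolating_nbhs : exists V : set G, [/\ open V, V 1 &
  forall h k z x y, set_expg L 2 h -> set_expg L 2 k -> L z -> V x -> V y ->
    h * z * k^-1 = x^-1 * y -> x = y].
Proof.
have [_ [W W1 WL]] := ud.
have cf : continuous (fun z : G * G => z.1^-1 * z.2).
  apply: continuous_mulg; last by move=> -[? ?]; exact: cvg_snd.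
  by apply: continuous_invg => -[? ?]; exact: cvg_fst.
have [V [oV V1 VW]] := open_nbhs1_pair (f := fun z => z.1^-1 * z.2) cf
  (O := W) ltac:(by rewrite /= invg1 mulg1).
exists V; split=> // h k z x y Lh Lk Lz Vx Vy hzk.
have : (W `&` self_quot (set_expg L 3)) (x^-1 * y).
  by split; [exact: (VW _ _ Vx Vy)|rewrite -hzk; apply: expg2_sandwich => //;
    exact: self_quot1].
by rewrite WL /= => xy; rewrite -(mulVKg x y) xy mulg1.
Qed.

Lemma uniformly_discrete_self_quot : uniformly_discrete L.
Proof.
have [V [oV V1 VP]] := isolating_nbhs; have L1 := self_quot1; split.
  by apply/mem_set/self_quotP; exists 1, 1; rewrite invg1 mulg1.
exists V; first exact: open_nbhs_nbhs.
apply/seteqP; split=> [z [Vz /self_quotP [x [y [Lx Ly zE]]]]|_ ->] /=.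
  apply/esym; apply: (VP x^-1 y^-1 1) => //.
  - exact/sub_expg2/self_quotV.
  - exact/sub_expg2/self_quotV.
  - by rewrite mulg1 invgK invg1 mul1g.
by split=> //; apply/self_quotP; exists 1, 1; rewrite invg1 mulg1.
Qed.

(** A translate [x V] contains at most one point of [L], so a limit point [x]
    of [L] is the only point of [L] near [x]. *)
Lemma self_quot_closed : hausdorff_space G -> closed L.
Proof.
move=> hG; have [V [oV V1 VP]] := isolating_nbhs.
move=> x clx.
have nx (B : set G) : nbhs (1 : G) B -> nbhs x [set y | B (x^-1 * y)].
  move=> B1; apply: (nbhs_continuous_open (f := fun y => x^-1 * y)).
    exact: continuous_mulgl.
  by rewrite mulVg.
have nV := nx V (open_nbhs_nbhs (conj oV V1)).
have [a [La Va]] := clx _ nV.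
suff -> : x = a by [].
apply: hG => B C nB nC.
have [b [Lb [Vb Bb]]] := clx _ (filterI nV nB).
exists b; split=> //.
suff -> : b = a by exact: nbhs_singleton.
apply/esym/(@mulgI G x^-1).
apply: (VP a^-1 b^-1 1) => //.
- exact/sub_expg2/self_quotV.
- exact/sub_expg2/self_quotV.
- exact: self_quot1.
- by rewrite mulg1 !invgM !invgK mulgA mulgK.
Qed.

End Difference.

(** * Finiteness of separated families *)

Section Covering.
Context {R : realType} {G : topologicalGroupType}.
Local Notation T := (borel_group G).
Hypothesis hausdorffG : hausdorff_space G.
Hypothesis second_countableG : @second_countable G.
Variable A : set G.
Local Notation L := (self_quot A).
Hypothesis ud : uniformly_discrete (set_expg L 3).
Variables (w : ext_hull A) (nu : probability (borel_subspace w) R).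
Hypothesis nu_proper : proper_measure nu.
Hypothesis nu_invariant : invariant_measure nu.

Local Notation Omega := (borel_subspace w).
Local Notation C := (fun X : Omega => cset (set_val X) : set T).

Local Lemma sample_difference (X : Omega) x y : C X x -> C X y -> L (x^-1 * y).
Proof.
move=> Xx Xy; have /closure_id -> := self_quot_closed ud hausdorffG.
by apply: (set_valP (X : ext_hull A)); apply/self_quotP; exists x, y.
Qed.

Local Lemma measurable_hits_open (O : set T) : open O -> measurable (hits C O).
Proof.
move=> oO; apply: sub_sigma_algebra; exists (fell_hit O) => //.
exact: open_fell_hit.
Qed.

Local Definition shift (g : G) (X : Omega) : Omega :=
  SigSub (mem_set (@ext_hull_translate _ g _ _ (set_valP (X : ext_hull A)))).

Local Lemma shift_val g X : set_val (shift g X) = translate g (set_val X).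
Proof. exact: erefl. Qed.

Local Lemma shiftP g X x : C (shift g X) x <-> C X (g^-1 * x).
Proof. exact: translateP. Qed.

Local Lemma shift_invariant g E :
  measurable E -> nu (shift g @^-1` E) = nu E.
Proof.
move=> mE; rewrite -[RHS](nu_invariant g^-1 mE); congr (nu _).
apply/seteqP; split=> [Y EY|Y [X EX YX]].
  by exists (shift g Y) => //; rewrite shift_val (@translateK G g (set_val Y)).
rewrite /preimage /= (_ : shift g Y = X)//; apply: val_inj => /=.
by rewrite [\val Y]YX; exact: translateVK.
Qed.

Local Lemma hits_setT_neq0 : nu (hits C setT) != 0%E.
Proof.
have mC := measurable_hits_open openT.
rewrite -[hits C setT]setCK probability_setC; last exact: measurableC.
rewrite (_ : ~` _ = [set X : Omega | cset (set_val X) = set0]).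
  by rewrite nu_proper sube0 onee_neq0.
apply/seteqP; split=> X /=.
  move=> nX; rewrite -subset0 => x Xx; apply: nX; exists x; split=> //.
by move=> X0 [x [Xx _]]; rewrite X0 in Xx.
Qed.

(** The lower bound is [right_translate_lower_bound] at [h^-1]: the random set
    has at most one point in [V h^-1], whose intensity is thus a probability.
    As for disjointness, if [X] meets [U h] at [x] and [U k] at [y], then
    [x h^-1] and [y k^-1] are equal by [isolating_nbhs], so that [h^-1 k] is
    [x^-1 y]. *)
Lemma expg2_translates_bound : exists (U : set G) (c : R),
  [/\ open U, (0 < c)%R,
      forall h, set_expg L 2 h ->
        (c%:E <= nu (hits C [set y : T | U (y * h^-1)%g]))%E &
      forall h k, set_expg L 2 h -> set_expg L 2 k -> ~ L (h^-1 * k) ->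
        hits C [set y : T | U (y * h^-1)] `&` hits C [set y : T | U (y * k^-1)]
          = set0].
Proof.
have L1 := self_quot1 ud.
have LL1 := expg2_1 ud.
have [V [oV V1 VP]] := isolating_nbhs ud.
have cfst : continuous (fst : G * G -> G) by move=> -[? ?]; exact: cvg_fst.
have csnd : continuous (snd : G * G -> G) by move=> -[? ?]; exact: cvg_snd.
(* U1 is there for U U to lie in V, and U2 for U^-1 to lie in V *)
have [U1 [oU1 U11 U1V]] := open_nbhs1_pair (f := fun z => z.1 * z.2) (O := V)
  (continuous_mulg cfst csnd) ltac:(by rewrite /= mulg1; apply: open_nbhs_nbhs).
have [U2 [oU2 U21 U2V]] := open_nbhs1_pair (f := fun z => z.1^-1 * z.2) (O := V)
  (continuous_mulg (continuous_invg cfst) csnd)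
  ltac:(by rewrite /= invg1 mulg1; apply: open_nbhs_nbhs).
pose U : set T := U1 `&` U2.
have oU : open U by exact: openI.
have UV x y : U x -> U y -> V (x * y).
  by move=> [U1x _] [U1y _]; exact: (U1V x y).
have UsubV : U `<=` V by move=> x [U1x _]; rewrite -[x]mul1g; exact: (U1V 1 x).
have UiV : [set y : T | U y^-1] `<=` V.
  by move=> x [_ U2x]; rewrite -[x]invgK -[_^-1]mulg1; exact: (U2V x^-1 1).
have mV : measurable (V : set T) by exact: open_measurable_group.
have mU : measurable U by exact: open_measurable_group.
have thinVh h : set_expg L 2 h -> thin C [set y : T | V (y * h^-1)].
  move=> Lh X x y Xx Xy Vx Vy; apply: (@mulIg G h^-1).
  apply: (VP h h (x^-1 * y)) => //; first exact: (@sample_difference X).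
  by rewrite invgM invgK !mulgA.
have V1E : [set y : T | V (y * 1^-1)] = V.
  by apply/seteqP; split=> y /=; rewrite invg1 mulg1.
have thinV : thin C V by rewrite -V1E; exact: thinVh.
(* translates of V form the countable thin cover on which mu is built *)
have [g gV] := translates_cover second_countableG oV V1.
pose Vn n : set T := [set x | V (g n * x)].
have oVn n : open (Vn n).
  by apply: open_comp => // x _; exact: continuous_mulgl.
have thinVn n : thin C (Vn n) by exact: (thin_left_translate shiftP).
pose mu : {sigma_finite_measure set T -> \bar R} :=
  intensity nu measurable_hits_open oVn thinVn gV.
have mu_thin B : measurable B -> thin C B -> mu B = nu (hits C B).
  exact: intensity_thin.
have mu_inv (a : T) (B : set T) : measurable B -> mu [set x | B (a * x)] = mu B.
  exact: (intensity_left_invariant _ _ _ _ shiftP shift_invariant).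
have mu_neq0 : mu setT != 0%E by exact: (intensity_neq0 _ _ _ _ hits_setT_neq0).
have muU_gt0 : (0 < mu U)%E.
  by apply: (open_measure_gt0 second_countableG mu_inv) => //; split.
have mhits B : measurable B -> measurable (hits C B).
  exact: (measurable_hits_borel measurable_hits_open oVn thinVn gV).
have mu_thin_le1 B : measurable B -> thin C B -> (mu B <= 1)%E.
  by move=> mB tB; rewrite mu_thin//; apply: probability_le1; exact: mhits.
have [u muUE] : exists u, mu U = u%:E.
  exists (fine (mu U)); rewrite fineK// ge0_fin_numE ?measure_ge0//.
  apply: (@le_lt_trans _ _ 1%E); last exact: ltry.
  by apply: mu_thin_le1 => //; exact: sub_thin thinV.
have u_gt0 : (0 < u)%R by rewrite -lte_fin -muUE.
have mUi := measurable_invg mU.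
exists U, (u ^+ 3 / 4)%R; split=> //.
- by rewrite divr_gt0// exprn_gt0.
- move=> h Lh; have Lh' := expg2_self_quotV Lh.
  rewrite -mu_thin; last 2 first.
  + exact: measurable_mulgr.
  + apply: (sub_thin (B := [set y : T | V (y * h^-1)])); last exact: thinVh.
    by move=> y; exact: UsubV.
  apply: (right_translate_lower_bound second_countableG mu_inv mU mV) => //.
  + by apply: mu_thin_le1 => //; exact: sub_thin thinV.
  + by apply: mu_thin_le1; [exact: measurable_mulgr|exact: thinVh].
- move=> h k Lh Lk nL; rewrite -subset0 => X [[x [Xx Ux]] [y [Xy Uy]]].
  apply: nL.
  have xy : x * h^-1 = y * k^-1.
    apply: (VP h k (x^-1 * y)) => //.
    + exact: (@sample_difference X).
    + exact: UsubV.
    + exact: UsubV.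
    + by rewrite invgM invgK !mulgA.
  have -> : h^-1 * k = x^-1 * y.
    by rewrite -[y](mulgVK k) -xy !mulgA mulVg mul1g.
  exact: (@sample_difference X).
Qed.

(** If no finite [F] works, an element [h] of [L^2] with all [k^-1 h] outside
    [L] can always be added to a finite family, and the event of hitting one
    of the members gains probability at least [c] each time. *)
Lemma separated_family_measure (U : set G) (c : R) n :
  open U ->
  (forall h, set_expg L 2 h ->
    (c%:E <= nu (hits C [set y : T | U (y * h^-1)%g]))%E) ->
  (forall h k, set_expg L 2 h -> set_expg L 2 k -> ~ L (h^-1 * k) ->
    hits C [set y : T | U (y * h^-1)] `&` hits C [set y : T | U (y * k^-1)]
      = set0) ->
  (forall F, finite_set F -> ~ (set_expg L 2 `<=` set_mulg F L)) ->
  exists (F : set G) (E : set Omega), [/\ finite_set F, F `<=` set_expg L 2,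
    measurable E,
    forall X, E X -> exists2 h, F h & hits C [set y : T | U (y * h^-1)] X
    & ((n%:R * c)%:E <= nu E)%E].
Proof.
move=> oU Uc Udisj noF; elim: n => [|n [F [E [finF FL mE EF nE]]]].
  by exists set0, set0; split=> //; rewrite measure0 mul0r.
have [h [Lh hF]] : exists h, set_expg L 2 h /\ forall k, F k -> ~ L (k^-1 * h).
  apply: contrapT => nh; apply: (noF F finF) => h Lh; apply: contrapT => nFL.
  apply: nh; exists h; split=> // k Fk Lkh; apply: nFL.
  by exists k => //; exists (k^-1 * h); rewrite ?mulVKg.
have mh : measurable (hits C [set y : T | U (y * h^-1)]).
  apply: measurable_hits_open; apply: open_comp => // x _.
  exact: continuous_mulgr.
exists (h |` F), (E `|` hits C [set y : T | U (y * h^-1)]); split.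
- by rewrite finite_setU; split.
- by move=> k [->//|]; exact: FL.
- exact: measurableU.
- by move=> X [/EF [k Fk kX]|hX]; [exists k => //; right|exists h => //; left].
- rewrite measureU//.
    rewrite -[n.+1]addn1 natrD mulrDl mul1r EFinD; apply: leeD => //.
    exact: Uc.
  rewrite -subset0 => X [/EF [k Fk kX] hX].
  by rewrite -(Udisj k h (FL _ Fk) Lh (hF k Fk)); split.
Qed.

(** A probability cannot exceed [1], so the families of
    [separated_family_measure] cannot have more than [1 / c] members. *)
Theorem approx_subgroup_self_quot : approx_subgroup L.
Proof.
split; [exact: self_quot1|exact: self_quot_inv|].
apply: contrapT => nF.
have [U [c [oU c0 Uc Udisj]]] := expg2_translates_bound.
have [|F [E [_ _ mE _]]] :=
    @separated_family_measure U c (Num.Def.archi_bound c^-1) oU Uc Udisj _.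
  by move=> F finF FL; apply: nF; exists F.
apply/negP; rewrite -ltNge; apply: le_lt_trans (probability_le1 nu mE) _.
rewrite lte_fin -ltr_pdivrMr// mul1r; apply: archi_boundP.
by rewrite invr_ge0 ltW.
Qed.

End Covering.

Theorem corollary5 (R : realType) (G : topologicalGroupType)
    (hausdorffG : hausdorff_space G)
    (locally_compactG : locally_compact [set: G])
    (second_countableG : @second_countable G)
    (X0 : closed_subset G)
    (X0_unif_discrete : uniformly_discrete (set_expg (self_quot X0) 3))
    (measure_on_hull :
      carries_proper_invariant_probability R (ext_hull X0) \/
      carries_proper_invariant_probability R (hull X0)) :
  approx_subgroup (self_quot X0) /\ star_approx_lattice R (self_quot X0).
Proof.
have ext : carries_proper_invariant_probability R (ext_hull X0).
  case: measure_on_hull => //; apply: carries_sub => [|g X].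
    exact: hull_sub_ext_hull.
  exact: hull_translate.
have L1 := self_quot1 X0_unif_discrete.
have AS : approx_subgroup (self_quot X0).
  by have [w [nu [nuP nuI]]] := ext; exact: approx_subgroup_self_quot nuP nuI.
split=> //; split=> //.
  exact: uniformly_discrete_self_quot.
apply: carries_sub ext => [X|g X]; last exact: ext_hull_translate.
move=> XX0; apply: (subset_trans XX0); apply: closure_subset => z Lz.
by apply/self_quotP; exists 1, z; rewrite invg1 mul1g.
Qed.
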